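(* Let $d\geq 3$. There are infinitely many number fields $K$ of degree $d$ with $\mathrm{ev}(K)=4$.
   Context: For a number field $K$, ''units'' means units of its ring of integers. A sum $\varepsilon_1+\dots+\varepsilon_k$ has a proper vanishing subsum if there is a nonempty proper subset $I\subsetneq\{1,\dots,k\}$ with $\sum_{i\in I}\varepsilon_i=0$. $\mathrm{ev}(K)$ is the smallest even $k\geq 4$ such that there exist units $\varepsilon_1,\dots,\varepsilon_k$ of $K$ with $\varepsilon_1+\dots+\varepsilon_k=0$ and no proper vanishing subsum ($\infty$ if none exists). *)

(* Defs.v *)
(* Number fields are the K : fieldExtType rat, of degree \dim {:K} over rat. *)
From HB Require Import structures.
From mathcomp Require Import all_boot all_order all_algebra all_field.
From mathcomp Require Import boolp.

Set Implicit Arguments.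
Unset Strict Implicit.
Unset Printing Implicit Defensive.

Import GRing.Theory.
Local Open Scope ring_scope.

Definition in_ring_of_integers (K : fieldExtType rat) (x : K) : Prop :=
  integralOver (intr : int -> K) x.

Definition is_unit (K : fieldExtType rat) (x : K) : Prop :=
  in_ring_of_integers x /\
  exists y : K, in_ring_of_integers y /\ x * y = 1.

Definition has_proper_vanishing_subsum (K : fieldExtType rat) (k : nat)
    (eps : 'I_k -> K) : Prop :=
  exists I : {set 'I_k},
    [/\ I != set0, I \proper [set: 'I_k] & \sum_(i in I) eps i = 0].

Definition has_minimal_unit_relation (K : fieldExtType rat) (k : nat) : Prop :=
  exists eps : 'I_k -> K,
    [/\ forall i, is_unit (eps i),
        \sum_(i < k) eps i = 0
      & ~ has_proper_vanishing_subsum eps].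

Definition ev_admissible (K : fieldExtType rat) : pred nat :=
  fun k => [&& ~~ odd k, (4 <= k)%N & `[< has_minimal_unit_relation K k >]].

(* [None] stands for the value infinity. *)
Definition ev (K : fieldExtType rat) : option nat :=
  match pselect (exists k, ev_admissible K k) with
  | left exk => Some (ex_minn exk)
  | right _ => None
  end.

Definition isomorphic_fields (K L : fieldExtType rat) : Prop :=
  exists f : {rmorphism K -> L}, bijective f.

(* Infinitely many means infinitely many up to isomorphism. Each number field
   has only finitely many embeddings into an algebraic closure of rat, so this
   agrees with counting the subfields of a fixed algebraic closure. *)
Definition infinitely_many_number_fields
    (P : fieldExtType rat -> Prop) : Prop :=
  exists K : nat -> fieldExtType rat,
    (forall n, P (K n)) /\
    (forall m n, m <> n -> ~ isomorphic_fields (K m) (K n)).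

(* Main.v *)
(* If x is a root of f_a = X^d + a (X^2 - 1), then f_a(1) = 1 and
   f_a(-1) = (-1)^d show that 1 - x and 1 + x are units, and
   (1 + x) + (1 - x) - 1 - 1 = 0 has no proper vanishing subsum unless x is 0,
   1 or -1. If p divides a exactly once, then f_a is Eisenstein at p, so Q(x) is
   totally ramified at p with residue field F_p, and any integer of Q(x) that is
   a root of f_c forces f_c to have a root modulo p.

   For every prime p some class c modulo p makes f_c rootless modulo p: for b^2
   distinct from 1, f_c(b) = 0 amounts to c = - b^d / (b^2 - 1), which leaves
   at most p - 2 values for c. Chinese remaindering then yields distinct primes
   p_n and integers a_n with p_n dividing a_n exactly once and f_(a_n) rootless
   modulo p_m for all m < n, so that the fields defined by the f_(a_n) are
   pairwise non-isomorphic. *)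
Require Import Defs.
From mathcomp Require Import all_boot all_order all_algebra all_field.
From mathcomp Require Import boolp ring.

Set Implicit Arguments.
Unset Strict Implicit.
Unset Printing Implicit Defensive.

Import GRing.Theory.
Local Open Scope ring_scope.

(** * The polynomials f_a and their irreducibility *)

Definition unit_poly (d : nat) (a : int) : {poly int} :=
  'X^d + a%:P * ('X^2 - 1).

Local Notation int_horner T x := (map_poly intr T).[x].

Lemma size_unit_poly (d : nat) (a : int) :
  (2 < d)%N -> size (unit_poly d a) = d.+1.
Proof.
move=> d_gt2; rewrite /unit_poly size_polyDl ?size_polyXn // ltnS.
rewrite (leq_trans (size_polyMleq _ _)) //.
rewrite size_XnsubC // addnS /=.
by rewrite (leq_trans (leq_add (size_polyC_leq1 a) (leqnn 2))).
Qed.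

Lemma coef_unit_poly (d : nat) (a : int) (i : nat) :
  (unit_poly d a)`_i = (i == d)%:R + a * ((i == 2)%:R - (i == 0)%:R).
Proof. by rewrite coefD coefXn mul_polyC coefZ coefB coefXn coef1. Qed.

Lemma lead_coef_unit_poly (d : nat) (a : int) :
  (2 < d)%N -> lead_coef (unit_poly d a) = 1.
Proof.
move=> d_gt2; rewrite lead_coefE size_unit_poly // coef_unit_poly /= eqxx.
by case: d d_gt2 => [|[|[|d]]] //= _; rewrite subrr mulr0 addr0.
Qed.

Lemma horner_unit_poly (R : comNzRingType) (d : nat) (a : int) (x : R) :
  int_horner (unit_poly d a) x = x ^+ d + a%:~R * (x ^+ 2 - 1).
Proof.
by rewrite rmorphD rmorphM rmorphB /= !map_polyXn map_polyC rmorph1 !hornerE.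
Qed.

Lemma unit_poly_irreducible (d p : nat) (a : int) :
    (2 < d)%N -> prime p -> (p %| a)%Z -> ~~ (p%:Z ^+ 2 %| a)%Z ->
  irreducible_poly (unit_poly d a).
Proof.
move=> d_gt2 p_pr p_a p2_a; apply: (eisenstein_crit p_pr).
- by rewrite size_unit_poly //; case: d d_gt2.
- by rewrite lead_coef_unit_poly // dvdz1; case: p p_pr {p_a p2_a} => [|[]].
- rewrite coef_unit_poly; case: d d_gt2 => //= d _.
  by rewrite add0r sub0r mulrN1 dvdzE abszN.
- move=> i; rewrite size_unit_poly //= coef_unit_poly => lt_i_d.
  by rewrite (ltn_eqF lt_i_d) add0r dvdz_mulr.
Qed.

(** The common root x keeps the gcd of q and r from being constant, so irreducibility makes it
    associate to q. *)
Lemma irreducible_root_dvdp (F : fieldType) (L : fieldExtType F)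
    (q r : {poly F}) (x : L) :
    irreducible_poly q ->
    root (map_poly (in_alg L) q) x -> root (map_poly (in_alg L) r) x ->
  q %| r.
Proof.
move=> [q_gt1 q_irr] qx0 rx0.
have gcd_neq1 : size (gcdp q r) != 1%N.
  apply/negP; rewrite -/(coprimep q r) -(coprimep_map (in_alg L)).
  by move/coprimep_root => /(_ _ qx0); rewrite (rootP rx0) eqxx.
by rewrite -(eqp_dvdl _ (q_irr _ gcd_neq1 (dvdp_gcdl q r))) dvdp_gcdr.
Qed.

Lemma map_poly_intr_alg (L : fieldExtType rat) (T : {poly int}) :
  map_poly (in_alg L) (map_poly intr T) = map_poly intr T.
Proof.
by rewrite -map_poly_comp; apply: eq_map_poly => z; apply: rmorph_int.
Qed.

Lemma intr_fieldExt_eq0 (K : fieldExtType rat) (z : int) :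
  (z%:~R == 0 :> K) = (z == 0).
Proof. by rewrite -(rmorph_int (in_alg K)) fmorph_eq0 intr_eq0. Qed.

(** * Reduction at the totally ramified prime *)

Section TotallyRamified.

Variables (K : fieldExtType rat) (d p : nat) (a : int) (x : K).
Hypotheses (d_gt2 : (2 < d)%N) (p_pr : prime p).
Hypotheses (p_a : (p %| a)%Z) (p2_a : ~~ (p%:Z ^+ 2 %| a)%Z).
Hypothesis fx0 : int_horner (unit_poly d a) x = 0.

Let pcharFp := pchar_Fp p_pr.

Lemma unit_poly_root_neq0 : x != 0.
Proof.
apply: contra p2_a => /eqP x0; have /eqP := fx0.
rewrite horner_unit_poly x0 !expr0n (gtn_eqF (ltnW (ltnW d_gt2))) add0r sub0r.
by rewrite mulrN1 oppr_eq0 intr_fieldExt_eq0 => /eqP->; apply: dvdz0.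
Qed.

(** By Gauss's lemma f_a divides T over the integers, and p divides f_a(0) = -a. Hence T(x) -> T(0)
    mod p is a well-defined reduction of Z[x], sending x to 0. *)
Lemma horner0_eq0_modp (T : {poly int}) :
  int_horner T x = 0 -> (T.[0])%:~R = 0 :> 'F_p.
Proof.
move=> Tx0.
have : map_poly intr (unit_poly d a) %| map_poly (intr : int -> rat) T.
  apply: (@irreducible_root_dvdp _ K _ _ x).
  - exact/irreducible_rat_int/(unit_poly_irreducible d_gt2 p_pr).
  - by rewrite map_poly_intr_alg; apply/rootP.
  - by rewrite map_poly_intr_alg; apply/rootP.
rewrite dvdp_rat_int => /dvdpP_int[r ->].
rewrite zprimitive_monic ?monicE ?lead_coef_unit_poly //.
apply/eqP; rewrite -(dvdz_pcharf pcharFp) hornerM dvdz_mulr //.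
rewrite horner_coef0 coef_unit_poly; case: (d) d_gt2 => //= n _.
by rewrite add0r sub0r mulrN1 dvdzE abszN.
Qed.

(* The homogenisation of [unit_poly d c] at (U, W) vanishes at x, hence its
   constant term vanishes modulo p. *)
Lemma residue_relation (c : int) (y : K) (U W : {poly int}) :
    int_horner (unit_poly d c) y = 0 ->
    int_horner W x * y = int_horner U x ->
  let u : 'F_p := (U.[0])%:~R in let w : 'F_p := (W.[0])%:~R in
  u ^+ d + c%:~R * ((u ^+ 2 - w ^+ 2) * w ^+ (d - 2)) = 0.
Proof.
rewrite horner_unit_poly => fy0 WyU u w.
have := @horner0_eq0_modp
  (U ^+ d + c%:P * ((U ^+ 2 - W ^+ 2) * W ^+ (d - 2))).
rewrite !(hornerE, rmorphD, rmorphM, rmorphN, rmorphXn, map_polyC) /= -/u -/w.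
rewrite [map_poly _ c%:P]map_polyC hornerC.
rewrite -WyU [_ * y]mulrC; set z := (map_poly _ W).[x] => ->; first by ring.
have -> : (y * z) ^+ d = y ^+ d * (z ^+ 2 * z ^+ (d - 2)).
  by rewrite -exprD subnKC 1?ltnW // exprMn.
have /(congr1 ( *%R^~ (z ^+ 2 * z ^+ (d - 2)))) := fy0.
by rewrite mul0r => <-; ring.
Qed.

Hypothesis x_gen : <<1; x>>%VS = fullv.

Lemma unit_poly_root_fraction (y : K) :
  exists (B : {poly int}) (N : int),
    [/\ (size B <= d)%N, N%:~R * y = int_horner B x
      & ~~ ((p %| N)%Z && (p %| zcontents B)%Z)].
Proof.
have /Fadjoin_polyP[_ /polyOver1P[P ->] Dy] : y \in <<1; x>>%VS.
  by rewrite x_gen memvf.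
pose fQ : {poly rat} := map_poly intr (unit_poly d a).
have fQ_neq0 : fQ != 0.
  by rewrite -size_poly_eq0 size_rat_int_poly size_unit_poly.
(* Reducing modulo f_a bounds the size of B; clearing denominators produces N. *)
have [B [N N_neq0 DP]] := rat_poly_scale (P %% fQ).
have szB : (size B <= d)%N.
  have := ltn_modp P fQ; rewrite fQ_neq0 DP size_scale ?invr_eq0 ?intr_eq0 //.
  by rewrite !size_rat_int_poly size_unit_poly.
have Ny : N%:~R * y = int_horner B x.
  have -> : y = (map_poly (in_alg K) (P %% fQ)).[x].
    rewrite Dy {1}(divp_eq P fQ) rmorphD rmorphM /= hornerD hornerM.
    by rewrite map_poly_intr_alg fx0 mulr0 add0r.
  rewrite -(rmorph_int (in_alg K)) -hornerZ -linearZ /= DP.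
  by rewrite scalerKV ?intr_eq0 // map_poly_intr_alg.
(* Cancelling g leaves p unable to divide both N and the content, as p g would then divide g. *)
set g := gcdz N (zcontents B).
have g_neq0 : g != 0 by rewrite gcdz_eq0 (negPf N_neq0).
have /dvdzP[N' DN] : (g %| N)%Z := dvdz_gcdl _ _.
have /dvdzP[e De] : (g %| zcontents B)%Z := dvdz_gcdr _ _.
exists (e *: zprimitive B), N'; split.
- by rewrite (leq_trans (size_scale_leq _ _)) ?size_zprimitive.
- have gK_neq0 : g%:~R != 0 :> K by rewrite intr_fieldExt_eq0.
  apply: (mulfI gK_neq0); rewrite mulrA -rmorphM /= [g * _]mulrC -DN Ny.
  by rewrite {1}[B]zpolyEprim De mulrC -scalerA !map_polyZ !hornerZ.
- apply/negP => /andP[p_N']; rewrite zcontentsZ zcontents_primitive => p_e.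
  have {}p_e : (p %| e)%Z.
    (* The primitive part of 0 has content 0 instead of 1; in that case e g = 0 forces e = 0. *)
    have [B0 | B_neq0] := eqVneq B 0; last by rewrite B_neq0 mulr1 in p_e.
    have /eqP := De; rewrite B0 zcontents0 eq_sym mulf_eq0 (negPf g_neq0) orbF.
    by move/eqP->.
  have : (p%:Z * g %| gcdz N (zcontents B))%Z.
    by rewrite dvdz_gcd DN De !dvdz_mul2r ?p_N'.
  rewrite -/g -{1}[g]mul1r dvdz_mul2r // dvdz1 /= => /eqP p1.
  by move: p_pr; rewrite p1.
Qed.

Lemma unit_poly_residue_root (c : int) (y : K) :
    int_horner (unit_poly d c) y = 0 ->
  exists b : 'F_p, b ^+ d + c%:~R * (b ^+ 2 - 1) = 0.
Proof.
move=> fy0; have [B [N [szB Ny N_B]]] := unit_poly_root_fraction y.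
have d_gt0 : (0 < d)%N by rewrite (leq_trans _ d_gt2).
have [p_N | p'N] := boolP (p %| N)%Z; last first.
  have := @residue_relation c y B N%:P fy0.
  rewrite map_polyC !hornerC => /(_ Ny).
  set u := (B.[0])%:~R; set w := N%:~R => /= rel.
  have w_neq0 : w != 0 by rewrite /w -(dvdz_pcharf pcharFp).
  (* Since x reduces to 0, the residue of y = B(x) / N is B(0) / N. *)
  exists (u / w); rewrite -(mul0r (w ^+ d)^-1) -rel.
  have -> : w ^+ d = w ^+ 2 * w ^+ (d - 2) by rewrite -exprD subnKC // ltnW.
  have -> : (u / w) ^+ d = u ^+ d / (w ^+ 2 * w ^+ (d - 2)).
    by rewrite -exprD subnKC 1?ltnW // expr_div_n.
  by field; rewrite w_neq0 expf_neq0.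
(* When p divides the denominator N, trade p for x: as
   x^d = a (1 - x^2), the factor p is x^d up to elements prime to p. This
   rewrites B(x) / N as V(x) / W(x) with W(0) = 0 and V(0) prime to p, which
   [residue_relation] forbids. *)
have exB : exists j, ~~ (p %| B`_j)%Z.
  move: N_B; rewrite p_N /= dvdz_contents => p'B.
  apply: contrapT => noB; case/negP: p'B; apply/polyOverP => j.
  by apply: contrapT => /negP p'Bj; apply: noB; exists j.
(* Below the first coefficient prime to p, all terms of B are divisible by p; the bound j < d makes
   X^(d - j) vanish at 0. *)
have [j p'Bj j_min] := ex_minnP exB.
have lt_j_d : (j < d)%N.
  rewrite (leq_trans _ szB) // ltnNge; apply: contra p'Bj => szB_j.
  by rewrite nth_default // dvdz0.
have /dvdzP[a1 Da] := p_a; have /dvdzP[N1 DN] := p_N.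
have p'a1 : a1%:~R != 0 :> 'F_p.
  rewrite -(dvdz_pcharf pcharFp); apply: contra p2_a => p_a1.
  by rewrite Da expr2; apply: dvdz_mul.
pose T := \poly_(i < j) (B`_i %/ p)%Z.
have DB : B = p%:Z%:P * T + 'X^j * drop_poly j B.
  apply/polyP=> i; rewrite coefD coefCM coef_poly coefXnM coef_drop_poly.
  have [lt_i_j | le_j_i] := ltnP i j; last by rewrite mulr0 add0r subnK.
  rewrite addr0 mulrC divzK //; apply: contraLR lt_i_j => p'Bi.
  by rewrite -leqNgt j_min.
(* Multiplying N y = B(x) by a1 (1 - x^2) turns each factor p into x^d; dividing by x^j then gives
   W(x) y = V(x) with W = N1 X^(d - j). *)
pose V := 'X^(d - j) * T + a1%:P * (1 - 'X^2) * drop_poly j B.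
have x_neq0 := unit_poly_root_neq0.
have xd : x ^+ d = a1%:~R * p%:~R * (1 - x ^+ 2).
  have /eqP := fx0; rewrite horner_unit_poly addr_eq0 => /eqP->.
  by rewrite Da rmorphM /=; ring.
have VyW : int_horner ('X^(d - j) * N1%:P) x * y = int_horner V x.
  have := Ny; rewrite DN DB /V !(rmorphD, rmorphM, rmorphN, rmorph1).
  rewrite /= !map_polyXn !map_polyC.
  rewrite ?map_polyX !(hornerD, hornerM, hornerN, hornerC, hornerXn, hornerX).
  set t := (map_poly _ T).[x]; set u := (map_poly _ _).[x] => NyE.
  apply: (mulfI (expf_neq0 j x_neq0)).
  have -> z : x ^+ j * (x ^+ (d - j) * z * y) = x ^+ d * z * y.
    by rewrite !mulrA -exprD subnKC // ltnW.
  have -> z : x ^+ j * (x ^+ (d - j) * t + z) = x ^+ d * t + x ^+ j * z.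
    by rewrite mulrDr mulrA -exprD subnKC // ltnW.
  rewrite xd; transitivity (a1%:~R * (1 - x ^+ 2) * (N1%:~R * p%:~R * y)).
    by rewrite /=; ring.
  by rewrite NyE /=; ring.
(* Here w = 0 and d - 2 > 0, so the relation reads u^d = 0, although u = a1 B_j is nonzero modulo
   p. *)
have := residue_relation fy0 VyW.
rewrite /V !(hornerD, hornerM, hornerN, hornerC, hornerXn, hornerX).
rewrite !expr0n subn_eq0 (leqNgt d) lt_j_d !mul0r !add0r subr0 mulr1.
rewrite mulr0z !expr0n subn_eq0 (leqNgt d) d_gt2 horner_coef0 coef_drop_poly add0n.
rewrite !mulr0 addr0 => /eqP; rewrite expf_eq0 d_gt0 /= rmorphM mulf_eq0.
by rewrite (negPf p'a1) -(dvdz_pcharf pcharFp) (negPf p'Bj).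
Qed.

End TotallyRamified.


(** * Rootless classes, Chinese remaindering and a sequence of primes *)

Lemma nonsurjective_unit_poly_family (F : finFieldType) (d : nat) :
  (0 < d)%N -> exists c : F, forall b : F, b ^+ d + c * (b ^+ 2 - 1) != 0.
Proof.
(* Since z / 0 = 0, h takes the value 0 at both 0 and 1. *)
move=> d_gt0; pose h (b : F) := - b ^+ d / (b ^+ 2 - 1).
have [c c_h] : exists c, forall b, h b != c.
  apply: contrapT => h_surj.
  (* On a finite field a surjective h would be injective, against h(0) = h(1). *)
  have h_onto c : c \in codom h.
    apply: contrapT => /negP h'c; apply: h_surj; exists c => b.
    by apply: contraNneq h'c => <-; apply: codom_f.
  have /card_uniqP : #|codom h| = size (codom h).
    by rewrite size_codom; apply: eq_card => c; rewrite h_onto.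
  move/injectiveP => h_inj.
  have /h_inj/eqP : h 0 = h 1.
    by rewrite /h expr0n (gtn_eqF d_gt0) oppr0 mul0r !expr1n subrr invr0 mulr0.
  by rewrite eq_sym oner_eq0.
exists c => b; apply: contra_neqN (c_h b) => /eqP fb0.
(* When b^2 = 1 the polynomial takes the value b^d, which is nonzero whatever c is. *)
have [b2 | b2_neq] := eqVneq (b ^+ 2 - 1) 0.
  move/eqP: fb0; rewrite b2 mulr0 addr0 expf_eq0 d_gt0 /= => /eqP b0.
  by move/eqP: b2; rewrite b0 expr0n sub0r oppr_eq0 oner_eq0.
move/eqP: fb0; rewrite addr_eq0 -eqr_oppLR /h => /eqP->.
by rewrite mulfK.
Qed.

Lemma chinese_remainder_family (m r : nat -> nat) (n : nat) :
    (forall i j, i != j -> coprime (m i) (m j)) ->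
  exists z, forall i, (i < n)%N -> z = r i %[mod m i].
Proof.
move=> co_m; elim: n => [|n [z Dz]]; first by exists 0%N.
have co_n : coprime (\prod_(i < n) m i) (m n).
  elim/big_ind: _ => [|u v co_u co_v|i _]; first exact: coprime1n.
    by rewrite coprimeMl co_u.
  by rewrite co_m // ltn_eqF.
exists (chinese (\prod_(i < n) m i) (m n) z (r n)) => i.
rewrite ltnS leq_eqVlt => /predU1P[-> | lt_i_n]; first exact: chinese_modr.
have m_i : (m i %| \prod_(i < n) m i)%N.
  by rewrite (bigD1 (Ordinal lt_i_n)) //= dvdn_mulr.
by rewrite -(modn_dvdm _ m_i) chinese_modl // modn_dvdm // Dz.
Qed.

Lemma prime_sequence :
  exists p : nat -> nat, (forall n, prime (p n)) /\ injective p.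
Proof.
pose next n := s2val (prime_above n); pose p n := iter n next 2%N.
have next_gt n : (n < next n)%N by rewrite /next; case: prime_above.
have next_pr n : prime (next n) by rewrite /next; case: prime_above.
exists p; split=> [[|n] //|]; first exact: next_pr.
apply/incn_inj/leq_mono; apply: homo_ltn; first exact: ltn_trans.
by move=> n; apply: next_gt.
Qed.

(** * Units and the relation of length four *)

Lemma is_unit_opp1 (K : fieldExtType rat) : is_unit (-1 : K).
Proof.
have int_opp1 : in_ring_of_integers (-1 : K) by apply/integral_opp/integral1.
by split=> //; exists (-1); split; rewrite // mulrNN mulr1.
Qed.

Lemma unit_poly_root_1sub (K : fieldExtType rat) (d : nat) (a : int) (x : K) :
  (2 < d)%N -> int_horner (unit_poly d a) x = 0 -> is_unit (1 - x).
Proof.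
move=> d_gt2 fx0; have int_x : in_ring_of_integers x.
  by exists (unit_poly d a); [rewrite monicE lead_coef_unit_poly | apply/rootP].
split; first exact/integral_sub/int_x/integral1.
(* As f_a(1) = 1, the polynomial 1 - f_a is divisible by 1 - X; the inverse is the quotient at x. *)
exists (\sum_(i < d) x ^+ i + a%:~R * (1 + x)); split.
  apply: integral_add; last first.
    apply: integral_mul; first exact: integral_id.
    exact/integral_add/int_x/integral1.
  elim/big_ind: _ => [|u v|i _]; [exact: integral0 | exact: integral_add |].
  elim: (i : nat) => [|n IHn]; first exact: integral1.
  by rewrite exprS; apply: integral_mul.
have /(congr1 -%R) := subrX1 x d; rewrite opprB -mulNr opprB => Dgeom.
rewrite mulrDr -Dgeom -[RHS]subr0 -fx0 horner_unit_poly; ring.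
Qed.

(** The element -x is a root of f_c for c = (-1)^d a, which reduces this to the case of 1 - x. *)
Lemma unit_poly_root_1add (K : fieldExtType rat) (d : nat) (a : int) (x : K) :
  (2 < d)%N -> int_horner (unit_poly d a) x = 0 -> is_unit (1 + x).
Proof.
move=> d_gt2; rewrite horner_unit_poly => fx0; rewrite -[x]opprK.
apply: (@unit_poly_root_1sub _ d ((-1) ^+ d * a)) => //.
rewrite horner_unit_poly sqrrN (exprNn x) rmorphM rmorphXn rmorphN rmorph1 -mulrA.
by rewrite -mulrDr fx0 mulr0.
Qed.

Lemma is_unit_neq0 (K : fieldExtType rat) (x : K) : is_unit x -> x != 0.
Proof.
case=> _ [y [_ /eqP xy1]]; apply: contraTneq xy1 => ->.
by rewrite mul0r eq_sym oner_eq0.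
Qed.

Lemma ev_eq4 (K : fieldExtType rat) (x : K) :
  is_unit (1 + x) -> is_unit (1 - x) -> x != 0 -> ev K = Some 4.
Proof.
move=> u1 u2 x_neq0; have rel4 : has_minimal_unit_relation K 4.
  exists (tnth [tuple 1 + x; 1 - x; -1; -1]); split.
  - case=> [[|[|[|[|//]]]] lti4]; rewrite (tnth_nth 0) //=; exact: is_unit_opp1.
  - by rewrite !big_ord_recl big_ord0 !(tnth_nth 0) /=; ring.
  case=> I [I_neq0 I_proper]; pose b k := inord k \in I.
  have memI i : (i \in I) = b i by rewrite /b inord_val.
  rewrite big_mkcond !big_ord_recl big_ord0 !memI !lift0 !(tnth_nth 0) /= addr0.
  have I_const c : (forall i : 'I_4, b i = c) -> False.
    case: c => [I_T | I_0].
      by move: I_proper; rewrite properE => /andP[_ /subsetPn[i _]]; rewrite memI I_T.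
    by have /set0Pn[i] := I_neq0; rewrite memI I_0.
  have nonzero (z : K) : z != 0 -> forall s, s = z \/ s = - z -> s = 0 -> False.
    by move=> z_neq0 s [] -> /eqP; rewrite ?oppr_eq0 (negPf z_neq0).
  have nz_1 := nonzero 1 (oner_neq0 _).
  have nz_2 : forall s : K, s = 2 \/ s = - 2 -> s = 0 -> False.
    by apply: nonzero; rewrite (intr_fieldExt_eq0 K 2).
  have nz_x := nonzero x x_neq0.
  have nz_1Dx := nonzero _ (is_unit_neq0 u1).
  have nz_1Bx := nonzero _ (is_unit_neq0 u2).
  (* Up to sign, each of the 14 nonempty proper subsums is 1, 2, x, 1 + x or 1 - x; the last branch
     excludes the empty and the full set. *)
  case E0: (b 0%N); case E1: (b 1%N); case E2: (b 2%N); case E3: (b 3%N);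
    first [ by apply: nz_1; first [left; ring | right; ring]
          | by apply: nz_2; first [left; ring | right; ring]
          | by apply: nz_x; first [left; ring | right; ring]
          | by apply: nz_1Dx; first [left; ring | right; ring]
          | by apply: nz_1Bx; first [left; ring | right; ring]
          | by move=> _; apply: (I_const (b 0%N)); case=> [[|[|[|[|]]]]];
               rewrite //= ?E0 ?E1 ?E2 ?E3].
have adm4 : ev_admissible K 4 by apply/asboolP.
rewrite /ev; case: pselect => [exk | []]; last by exists 4.
case: ex_minnP => k /and3P[_ k_ge4 _] /(_ _ adm4) k_le4.
by congr Some; apply/eqP; rewrite eqn_leq k_le4.
Qed.

(** * Construction of the fields and of their parameters *)

Lemma unit_poly_field (d p : nat) (a : int) :
    (2 < d)%N -> prime p -> (p %| a)%Z -> ~~ (p%:Z ^+ 2 %| a)%Z ->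
  {K : fieldExtType rat & \dim {:K}%VS = d &
    {x : K | int_horner (unit_poly d a) x = 0 & <<1; x>>%VS = fullv}}.
Proof.
move=> d_gt2 p_pr p_a p2_a.
have /irreducible_rat_int/irredp_FAdjoin[K dimK [x fx0 x_gen]] :=
  unit_poly_irreducible d_gt2 p_pr p_a p2_a.
exists K; first by rewrite dimK size_rat_int_poly size_unit_poly.
by exists x => //; apply/rootP; rewrite -map_poly_intr_alg.
Qed.

Lemma unit_poly_parameters (d : nat) : (2 < d)%N ->
  exists (p : nat -> nat) (a : nat -> int), forall n,
    [/\ prime (p n), (p n %| a n)%Z, ~~ ((p n)%:Z ^+ 2 %| a n)%Z
      & forall m, (m < n)%N -> forall b : 'F_(p m),
          b ^+ d + (a n)%:~R * (b ^+ 2 - 1) != 0].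
Proof.
move=> d_gt2; have [p [p_pr p_inj]] := prime_sequence.
have d_gt0 : (0 < d)%N by rewrite (leq_trans _ d_gt2).
have /choice[c c_nr] : forall n, exists c : nat,
    forall b : 'F_(p n), b ^+ d + c%:R * (b ^+ 2 - 1) != 0.
  move=> n; have [c c_nr] := nonsurjective_unit_poly_family 'F_(p n) d_gt0.
  by exists c => b; rewrite natr_Zp.
suff /choice[a aP] : forall n, exists a, [/\ (p n %| a)%N, ~~ (p n ^ 2 %| a)%N
    & forall m, (m < n)%N -> a%:R = (c m)%:R :> 'F_(p m)].
  exists p, (Posz \o a) => n; have [p_a p2_a a_c] := aP n.
  by split=> // m lt_m_n b; rewrite -pmulrn a_c.
(* The class of p_n modulo p_n^2 makes p_n divide a exactly once; at the earlier primes a takes the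
   rootless class. *)
move=> n; pose m i := if i == n then (p n ^ 2)%N else p i.
pose r i := if i == n then p n else c i.
have [|a aP] := @chinese_remainder_family m r n.+1.
  have co_p i j : i != j -> coprime (p i) (p j).
    move=> neq_ij; rewrite prime_coprime // dvdn_prime2 //.
    by apply: contra neq_ij => /eqP/p_inj->.
  move=> i j neq_ij; rewrite /m.
  have [Di|_] := eqVneq i n; have [Dj|_] := eqVneq j n.
  - by rewrite Di Dj eqxx in neq_ij.
  - by rewrite coprimeXl // co_p -?Di.
  - by rewrite coprimeXr // co_p -?Dj.
  - exact: co_p.
have p_gt1 := prime_gt1 (p_pr n).
have := aP n (ltnSn n); rewrite /m /r eqxx => a_p.
exists a; split=> [||i lt_i_n].
- rewrite /dvdn -(@modn_dvdm (p n ^ 2)) ?dvdn_exp // a_p.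
  by rewrite modn_dvdm ?dvdn_exp // modnn.
- rewrite /dvdn a_p -/(_ %| _)%N.
  by rewrite gtnNdvd ?prime_gt0 // -mulnn ltn_Pmulr ?prime_gt0.
- have := aP i (leqW lt_i_n); rewrite /m /r (ltn_eqF lt_i_n) => a_c.
  by rewrite -Fp_nat_mod // a_c Fp_nat_mod.
Qed.

(** * Pairwise non-isomorphic fields *)

Theorem theorem6 (d : nat) (hd : (3 <= d)%N) :
  infinitely_many_number_fields
    (fun K : fieldExtType rat => \dim {:K}%VS = d /\ ev K = Some 4).
Proof.
have [p [a paP]] := unit_poly_parameters hd.
have HK n : {K : fieldExtType rat & \dim {:K}%VS = d &
    {x : K | int_horner (unit_poly d (a n)) x = 0 & <<1; x>>%VS = fullv}}.
  have [p_pr p_a p2_a _] := paP n.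
  exact: (@unit_poly_field d (p n)).
have {HK}[K dimK xK] := all_tag2 HK.
have no_root m n : (m < n)%N -> forall y : K m,
    int_horner (unit_poly d (a n)) y != 0.
  move=> lt_m_n y; apply/eqP=> fy0; have [p_pr p_a p2_a _] := paP m.
  have [x fx0 x_gen] := xK m.
  have [b] := unit_poly_residue_root hd p_pr p_a p2_a fx0 x_gen fy0.
  by have [_ _ _ /(_ m lt_m_n b)/eqP] := paP n.
exists K; split=> [n | m n neq_mn [f [g fK gK]]].
  have [p_pr p_a p2_a _] := paP n; have [x fx0 _] := xK n.
  split=> //; apply: (@ev_eq4 _ x).
  - exact: unit_poly_root_1add hd fx0.
  - exact: unit_poly_root_1sub hd fx0.
  - exact: unit_poly_root_neq0 hd p2_a fx0.
(* An isomorphism would carry the root in the later field to a root in the earlier one. The inverse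
   [g] is only a map, so for m < n the equation is checked after applying [f]. *)
have [lt_mn | lt_nm | //] := ltngtP m n.
  have [x fx0 _] := xK n; have /eqP[] := no_root _ _ lt_mn (g x).
  apply: (can_inj fK); rewrite rmorph0 -[RHS]fx0 !horner_unit_poly.
  by rewrite !(rmorphD, rmorphM, rmorphN, rmorphXn, rmorph_int, rmorph1) gK.
have [x fx0 _] := xK m; have /eqP[] := no_root _ _ lt_nm (f x).
rewrite -(rmorph0 f) -[in RHS]fx0 !horner_unit_poly.
by rewrite !(rmorphD, rmorphM, rmorphN, rmorphXn, rmorph_int, rmorph1).
Qed.
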